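(* Let $\mathbb{D}$ be a discrete valuation ring with uniformizer $z$, let $R\subset\mathbb{D}$ be a complete set of coset representatives of $\mathbb{D}$ over $z\mathbb{D}$ with $0\in R$, and let $\sigma:\mathbb{D}\to R$ be the map with $\sigma(a)\equiv a\pmod z$, applied componentwise to vectors. Consider a causal $\mathbb{D}$-linear network code on a network with $\omega$ source channels, and assume it is decodable at a node $v$ with delay $\delta\ge0$. Write $[\mathbf{f}_e]_{e\in In(v)}=\sum_{j\ge0}z^jF_j$ with the $F_j$ matrices over $R$. Then $\sum_{j=0}^\delta z^jF_j$ has $\omega$ (nonzero) invariant factors $z^{i_1},\dots,z^{i_\omega}$, all with $i_k\le\delta$. Let $\mathbf{U}$ ($\omega\times\omega$) and $\mathbf{V}$ ($|In(v)|\times|In(v)|$) be any invertible matrices over $\mathbb{D}$ such that $$\sum_{j=0}^\delta z^jF_j=\mathbf{U}\cdot\big[\,\mathrm{diag}(z^{i_1},\dots,z^{i_\omega})\ \ \mathbf{0}\,\big]\cdot\mathbf{V},$$ put $$\mathbf{A}=\mathbf{V}^{-1}\cdot\begin{bmatrix}\mathrm{diag}(z^{\delta-i_1},\dots,z^{\delta-i_\omega})\\ \mathbf{0}\end{bmatrix}\cdot\mathbf{U}^{-1},$$ write $\mathbf{A}=\sum_{j\ge0}z^jA_j$ with the $A_j$ matrices over $R$, and set $\mathbf{A}_0=\sum_{j=0}^\delta z^jA_j$. Then for every source data vector $\mathbf{m}=\sum_{j\ge0}z^jm_j\in\mathbb{D}^\omega$ (row vector, $m_j$ over $R$), with received vector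 $\mathbf{r}=\mathbf{m}\cdot[\mathbf{f}_e]_{e\in In(v)}=\sum_{j\ge0}z^jr_j$ ($r_j$ over $R$), one has $$m_0=\sigma\left(\frac{\big(\sum_{j=0}^\delta z^jr_j\big)\cdot\mathbf{A}_0}{z^\delta}\right),$$ and for all $t\ge1$ $$m_t=\sigma\left(\frac{\Big(\sum_{j=0}^{t+\delta}z^jr_j-\big(\sum_{j=0}^{t-1}z^jm_j\big)\cdot\big(\sum_{j=0}^{t+\delta}z^jF_j\big)\Big)\cdot\mathbf{A}_0}{z^{\delta+t}}\right),$$ where in each case the vector inside $\sigma$ has all its entries in $\mathbb{D}$.
   Context: A discrete valuation ring (DVR) is a local principal ideal domain that is not a field; its uniformizer $z$ generates the unique maximal ideal. Network: a finite directed multigraph (cycles allowed) whose edges are called channels, with a distinguished source node having exactly $\omega\ge 1$ outgoing channels (the source channels). $In(v)$ is the set of incoming channels of a node $v$. An adjacent pair $(d,e)$ consists of a channel $d$ ending at the node from which the channel $e$ starts. A $\mathbb{D}$-linear network code ($\mathbb{D}$-LNC) assigns a coding coefficient $k_{d,e}\in\mathbb{D}$ to every adjacent pair $(d,e)$. It is causal if around every cycle of the network there is at least one adjacent pair $(d,e)$ with $k_{d,e}$ divisible by $z$. Causality guarantees a unique assignment of coding vectors $\mathbf{f}_e\in\mathbb{D}^\omega$ (column vectors) to the channels $e$ such that the coding vectors of the $\omega$ source channels form the natural basis of $\mathbb{D}^\omega$ and $\mathbf{f}_e=\sum_{d\in In(v)}k_{d,e}\mathbf{f}_d$ for every outgoing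 channel $e$ of every non-source node $v$. $[\mathbf{f}_e]_{e\in In(v)}$ denotes the $\omega\times|In(v)|$ matrix with columns $\mathbf{f}_e$, $e\in In(v)$. The code is decodable at $v$ with delay $\delta\ge 0$ if there is an $|In(v)|\times\omega$ matrix $\mathbf{A}'$ over $\mathbb{D}$ with $[\mathbf{f}_e]_{e\in In(v)}\cdot\mathbf{A}'=z^\delta\mathbf{I}$, where $\mathbf{I}$ is the $\omega\times\omega$ identity matrix. Power series expression: every $x\in\mathbb{D}$ is uniquely of the form $\sum_{t\ge0}a_tz^t$ with $a_t\in R$, meaning $x\equiv\sum_{t=0}^{k-1}a_tz^t \pmod{z^k}$ for all $k\ge 0$. Applied entrywise, every matrix $\mathbf{M}$ over $\mathbb{D}$ is uniquely $\sum_{j\ge0}z^jM_j$ with each $M_j$ a matrix over $R$. The invariant factors of a matrix over $\mathbb{D}$ are the nonzero diagonal entries, normalized to powers of $z$, of its Smith normal form. The blocks $\mathbf{0}$ are the zero blocks of $|In(v)|-\omega$ columns, respectively rows. *)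

(* Defs.v *)
From HB Require Import structures.
From mathcomp Require Import all_boot all_order all_algebra.

Set Implicit Arguments.
Unset Strict Implicit.
Unset Printing Implicit Defensive.

Import GRing.Theory.
Local Open Scope ring_scope.

Section DiscreteValuationRing.
Variable D : idomainType.

Definition divides (a x : D) : Prop := exists b, x = b * a.

(* [idealr_closed] describes the proper ideals; the unit ideal is always
   principal, so nothing is lost by leaving it out here. *)
Definition principal_ideal_ring : Prop :=
  forall I : {pred D}, idealr_closed I ->
    exists a, forall x, x \in I <-> divides a x.

Definition maximal_ideal (I : {pred D}) : Prop :=
  idealr_closed I /\
  forall J : {pred D}, idealr_closed J -> {subset I <= J} -> {subset J <= I}.

Definition local_ring : Prop :=
  exists2 I : {pred D}, maximal_ideal I &
    forall J : {pred D}, maximal_ideal J -> J =i I.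

Definition is_dvr : Prop :=
  [/\ principal_ideal_ring, local_ring & ~ GRing.field_axiom D].

Definition uniformizer (z : D) : Prop :=
  exists2 I : {pred D}, maximal_ideal I & forall x, x \in I <-> divides z x.

Variables (z : D) (R : {pred D}).

Definition coset_representatives : Prop :=
  forall a, exists! r, r \in R /\ divides z (a - r).

Definition representative_map (sigma : D -> D) : Prop :=
  forall a, sigma a \in R /\ divides z (sigma a - a).

Definition power_series (x : D) (a : nat -> D) : Prop :=
  (forall t, a t \in R) /\
  (forall k, divides (z ^+ k) (x - \sum_(t < k) z ^+ t * a t)).

Definition power_series_mx m n (M : 'M[D]_(m, n)) (Mj : nat -> 'M[D]_(m, n)) :
    Prop :=
  forall i j, power_series (M i j) (fun t => Mj t i j).

(* The truncation keeps the powers of z up to and including z ^ d. *)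
Definition truncation m n (Mj : nat -> 'M[D]_(m, n)) (d : nat) : 'M[D]_(m, n) :=
  \sum_(j < d.+1) z ^+ j *: Mj j.

(* When m, n >= size d this is diag(d) padded by zero rows and columns. *)
Definition rect_diag m n (d : seq D) : 'M[D]_(m, n) :=
  \matrix_(i, j) (d`_i *+ (i == j :> nat)).

Definition smith_normal_form m n (M : 'M[D]_(m, n)) (s : seq nat) : Prop :=
  [/\ (size s <= minn m n)%N, sorted leq s &
      exists P Q, [/\ P \in unitmx, Q \in unitmx &
        M = P *m rect_diag m n [seq z ^+ i | i <- s] *m Q]].

(* s lists, in any order and with multiplicity, the exponents of the
   invariant factors of M. *)
Definition invariant_factors m n (M : 'M[D]_(m, n)) (s : seq nat) : Prop :=
  exists2 s', smith_normal_form M s' & perm_eq s s'.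

(* q is the vector y / c: the quotient, taken over the fraction field, has all
   its entries in D and q is the corresponding vector over D. *)
Definition is_quotient n (y : 'rV[D]_n) (c : D) (q : 'rV[D]_n) : Prop :=
  map_mx (@tofrac D) q = (tofrac c)^-1 *: map_mx (@tofrac D) y.

End DiscreteValuationRing.

Record network := Network {
  node : finType;
  channel : finType;
  tail : channel -> node;
  head : channel -> node;
  source : node
}.

Section LinearNetworkCode.
Variables (D : idomainType) (z : D) (N : network) (omega : nat).

Definition In (v : node N) : {set channel N} := [set e | head e == v].
Definition Out (v : node N) : {set channel N} := [set e | tail e == v].

Definition adjacent : rel (channel N) := [rel d e | head d == tail e].

(* Only the values of a code at adjacent pairs are ever used. *)
Variable k : channel N -> channel N -> D.

(* A cycle may visit a node several times but not repeat a channel: two loops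
   a, b at one node form the cycle [:: a; b], with pairs (a, b) and (b, a).
   Restricting to cycles with distinct nodes would not constrain k at those
   pairs, and the coding vectors could then fail to exist. *)
Definition causal : Prop :=
  forall c : seq (channel N), c != [::] -> ucycle adjacent c ->
    exists2 d, d \in c & divides z (k d (next c d)).

Variable f : channel N -> 'cV[D]_omega.

Definition coding_vectors : Prop :=
  perm_eq [seq f e | e in Out (source N)]
          [seq delta_mx i 0 | i : 'I_omega] /\
  (forall e, tail e != source N -> f e = \sum_(d in In (tail e)) k d e *: f d).

Definition received_mx (v : node N) : 'M[D]_(omega, #|In v|) :=
  \matrix_(i, j) f (enum_val j) i 0.

Definition decodable (v : node N) (delta : nat) : Prop :=
  exists A' : 'M[D]_(#|In v|, omega), received_mx v *m A' = (z ^+ delta)%:M.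

End LinearNetworkCode.

(* Main.v *)
Require Import Defs.
From HB Require Import structures.
From mathcomp Require Import all_boot all_order all_algebra perm.
From mathcomp Require boolp classical_sets.

Set Implicit Arguments.
Unset Strict Implicit.
Unset Printing Implicit Defensive.

Import GRing.Theory.
Local Open Scope ring_scope.

(** Write T for the truncation of the received matrix G modulo z^(delta+1).
    If G A' = z^delta I, then T A' = z^delta (I - z K) for some K. Comparing
    diagonal entries in T = P diag(z^s) Q, each z^(s_j) divides
    z^delta (1 - z x) for some x, and z does not divide 1 - z x: hence no
    diagonal entry vanishes and s_j <= delta. The matrix A satisfies
    T A = z^delta I by construction, so G A_0 = z^delta (I + z K') because G and
    A_0 differ from T and A by multiples of z^(delta+1). Multiplying
    the received vector, stripped of m_0, ..., m_(t-1), by A_0 therefore gives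
    z^(delta+t) (m_t + z w), and sigma recovers m_t. The Smith normal form
    comes from pivoting on an entry of least valuation, which is a unit after
    a power of z is factored out. *)

(** * Maximal ideals, units and finite valuations in a discrete valuation ring *)

Section LocalRing.
Variable D : idomainType.

(** A [Prop]-valued form of [idealr_closed]: divisibility and unions of chains come without a
    boolean test. *)
Definition ideal (I : D -> Prop) : Prop :=
  [/\ I 0, ~ I 1 & forall a u v, I u -> I v -> I (a * u + v)].

Lemma idealr_closed_asbool (I : D -> Prop) :
  ideal I -> idealr_closed [pred x | boolp.asbool (I x)].
Proof.
case=> I0 I1 Iadd; split; rewrite ?inE; first exact/boolp.asboolP.
  by apply/negP => /boolp.asboolP.
by move=> a u v /boolp.asboolP Iu /boolp.asboolP Iv; apply/boolp.asboolP/Iadd.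
Qed.

Lemma ideal_divides (x : D) : x \isn't a GRing.unit -> ideal (divides x).
Proof.
move=> x_nu; split.
- by exists 0; rewrite mul0r.
- by move=> [b /esym xV]; case/negP: x_nu; apply/unitrPr; exists b; rewrite mulrC.
- by move=> a _ _ [b ->] [c ->]; exists (a * b + c); rewrite mulrDl mulrA.
Qed.

(** Krull's theorem: Zorn's lemma applies to the proper ideals containing [x], because a union of a
    nonempty chain containing 1 would have a member containing 1. *)
Lemma nonunit_in_maximal_ideal (x : D) :
  x \isn't a GRing.unit -> exists2 I : {pred D}, maximal_ideal I & x \in I.
Proof.
move=> x_nu.
(* The empty set is admitted because it is the union of the empty chain. *)
pose P (A : D -> Prop) := (forall y, ~ A y) \/ (ideal A /\ A x).
have [F FP Ftot|A [PA maxA]] := @classical_sets.Zorn_bigcup D P.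
  have [[X [FX [y Xy]]]|F0] :=
    boolp.pselect (exists X, F X /\ exists y, X y); last first.
    by left=> y [X FX Xy]; apply: F0; exists X; split=> //; exists y.
  have idF Y u : F Y -> Y u -> ideal Y /\ Y x.
    by move=> FY Yu; have [/(_ u)|] := FP _ FY.
  have [[X0 X1 Xadd] Xx] := idF _ _ FX Xy.
  right; split; last by exists X.
  split; first by exists X.
    by case=> Y FY Y1; have [[_ /(_ Y1)]] := idF _ _ FY Y1.
  move=> a u v [Y FY Yu] [Z FZ Zv].
  have [[_ _ Yadd] _] := idF _ _ FY Yu; have [[_ _ Zadd] _] := idF _ _ FZ Zv.
  have [YZ|ZY] := Ftot _ _ FY FZ.
    by exists Z => //; apply: Zadd => //; apply: YZ.
  by exists Y => //; apply: Yadd => //; apply: ZY.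
have idx := ideal_divides x_nu.
have xx : divides x x by exists 1; rewrite mul1r.
case: PA => [A0|[[A0 A1 Aadd] Ax]].
  (* A maximal set is not empty: the ideal generated by [x] is strictly larger. *)
  case: (maxA (divides x)); last by right.
  by split=> [y /A0 //|/(_ x xx)/A0].
pose I : {pred D} := [pred y | boolp.asbool (A y)].
exists I; last by rewrite inE; apply/boolp.asboolP.
split=> [|J [J0 J1 Jadd] AJ y Jy].
  exact: (@idealr_closed_asbool A).
rewrite inE; apply/boolp.asboolP; apply: boolp.contrapT => nAy.
have AJ' u : A u -> u \in J.
  by move=> Au; apply: AJ; rewrite inE; apply/boolp.asboolP.
case: (maxA (fun u => u \in J)).
  by split=> [u /AJ' //|/(_ y Jy)/nAy].
right; split; last exact: AJ'.
by split=> [||a u v] //; [exact/negP | exact: Jadd].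
Qed.

(** A nonunit lies in some maximal ideal, which by locality is the one generated by [z]. *)
Lemma uniformizer_unit (z x : D) :
  local_ring D -> uniformizer z -> ~ divides z x -> x \is a GRing.unit.
Proof.
move=> [I maxI uniqI] [J maxJ JE] zNx; apply/negPn/negP => x_nu.
have [K maxK xK] := nonunit_in_maximal_ideal x_nu.
by apply/zNx/JE; rewrite (uniqI _ maxJ) -(uniqI _ maxK).
Qed.

Lemma uniformizer_nonunit (z : D) :
  uniformizer z -> z \isn't a GRing.unit.
Proof.
move=> [I [[_ /negP I1 _] _] IE]; apply/negP => z_unit; apply: I1.
by apply/IE; exists z^-1; rewrite mulVr.
Qed.

(** If [z = 0], the zero ideal is maximal, so the ideal generated by any nonunit is zero and [D] is
    a field. *)
Lemma uniformizer_neq0 (z : D) :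
  ~ GRing.field_axiom D -> uniformizer z -> z != 0.
Proof.
move=> Nfield [I [_ maxI] IE]; apply/eqP => z0; apply: Nfield => x x_neq0.
apply/negPn/negP => /ideal_divides/idealr_closed_asbool/maxI/=.
have sub : {subset I <= [pred y | boolp.asbool (divides x y)]}.
  move=> y /IE[b ->]; rewrite z0 mulr0 inE; apply/boolp.asboolP.
  by exists 0; rewrite mul0r.
move=> /(_ sub x); rewrite inE => /(_ _)/IE[].
  by apply/boolp.asboolP; exists 1; rewrite mul1r.
by move=> b /eqP; rewrite z0 mulr0 (negPf x_neq0).
Qed.

(* The elements divisible by all powers of [z] form an ideal [(a)] with
   [(a) = z (a)], so that [a = 0]. *)
Lemma powers_divide_eq0 (z x : D) :
    principal_ideal_ring D -> z != 0 -> z \isn't a GRing.unit ->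
  (forall n, divides (z ^+ n) x) -> x = 0.
Proof.
move=> PID z_neq0 z_nu zx.
pose I (y : D) := forall n, divides (z ^+ n) y.
have [|a aP] := PID [pred y | boolp.asbool (I y)].
  apply: idealr_closed_asbool; split.
  - by move=> n; exists 0; rewrite mul0r.
  - move=> /(_ 1%N)[b /esym zV]; case/negP: z_nu.
    by apply/unitrPr; exists b; rewrite mulrC.
  move=> c u v Iu Iv n; have [[b ->] [d ->]] := (Iu n, Iv n).
  by exists (c * b + d); rewrite mulrDl mulrA.
have {aP} IE y : I y <-> divides a y.
  by rewrite -aP inE; split=> /boolp.asboolP.
have Ia : I a by apply/IE; exists 1; rewrite mul1r.
have [b ab] := Ia 1%N; rewrite expr1 in ab.
(* Cancelling one [z] in [a = b * z] shows that [b] too is divisible by every power of [z]. *)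
have [c bc] : divides a b.
  apply/IE => n; have [d ad] := Ia n.+1; exists d.
  by apply: (mulIf z_neq0); rewrite -ab ad exprSr mulrA.
have a0 : a = 0.
  apply/eqP/negPn/negP => a_neq0; case/negP: z_nu; apply/unitrPr; exists c.
  rewrite [z * c]mulrC; suff -> : c * z = 1 by [].
  by apply: (mulIf a_neq0); rewrite mul1r mulrAC -bc -ab.
by have [d ->] := (IE x).1 zx; rewrite a0 mulr0.
Qed.

Lemma uniformizer_valuation (z x : D) :
  is_dvr D -> uniformizer z -> x != 0 ->
  exists n, ~ divides (z ^+ n) x.
Proof.
move=> [PID _ Nfield] unif_z x_neq0; apply: boolp.contrapT => zx.
have z_nu := uniformizer_nonunit unif_z.
have z_neq0 := uniformizer_neq0 Nfield unif_z.
case/eqP: x_neq0; apply: (powers_divide_eq0 PID z_neq0 z_nu) => n.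
by apply: boolp.contrapT => zNx; apply: zx; exists n.
Qed.

End LocalRing.

Lemma divides_mx (D : idomainType) (a : D) m n (M : 'M[D]_(m, n)) :
  (forall i j, divides a (M i j)) -> exists M', M = a *: M'.
Proof.
move=> aM.
have /fin_all_exists[B BE] : forall p : 'I_m * 'I_n, exists b, M p.1 p.2 = b * a.
  by move=> p; apply: aM.
exists (\matrix_(i, j) B (i, j)); apply/matrixP => i j.
by rewrite !mxE mulrC -BE.
Qed.

(** * Smith normal form by elimination with unit pivots *)

Section SmithNormalForm.
Variables (D : idomainType) (z : D).
Hypotheses (dvrD : is_dvr D) (unif_z : uniformizer z).

(** Factors [z] are removed from the whole matrix until some entry is a unit. A fixed nonzero entry,
    not divisible by [z ^+ d], bounds the number of rounds by [d]. *)
Lemma divide_out_pivot m n (M : 'M[D]_(m, n)) : M != 0 ->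
  exists e M' i j, M = z ^+ e *: M' /\ M' i j \is a GRing.unit.
Proof.
case/matrix0Pn => i0 [j0 M_neq0].
have [d] := uniformizer_valuation dvrD unif_z M_neq0.
elim: d M {M_neq0} => [|d IHd] M zNM.
  by case: zNM; exists (M i0 j0); rewrite mulr1.
have [zM|] := boolp.pselect (forall i j, divides z (M i j)); last first.
  move=> /boolp.existsNP[i /boolp.existsNP[j zNij]].
  exists 0%N, M, i, j; rewrite scale1r; split=> //.
  by have [_ loc _] := dvrD; apply: uniformizer_unit zNij.
have [M' ME] := divides_mx zM.
have [|e [M'' [i [j [M'E unitM'']]]]] := IHd M'.
  move=> [b M'ij]; apply: zNM; exists b.
  by rewrite ME mxE M'ij exprS mulrCA mulrA.
by exists e.+1, M'', i, j; rewrite exprS -scalerA -M'E.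
Qed.

Lemma rect_diag_nil m n : rect_diag m n [::] = 0 :> 'M[D]_(m, n).
Proof. by apply/matrixP => i j; rewrite !mxE nth_nil mul0rn. Qed.

Lemma rect_diag_cons m n (a : D) (s : seq D) :
  rect_diag m.+1 n.+1 (a :: s) =
    block_mx a%:M 0 0 (rect_diag m n s) :> 'M[D]_(1 + m, 1 + n).
Proof.
apply/matrixP => i j; rewrite /block_mx /rect_diag !mxE.
case: splitP => i' iE; rewrite !mxE; case: splitP => j' jE; rewrite !mxE iE jE.
- by rewrite !ord1.
- by rewrite ord1 mulr0n.
- by rewrite [j']ord1 mulr0n.
- by [].
Qed.

Lemma scale_rect_diag m n (a : D) (s : seq D) :
  a *: rect_diag m n s = rect_diag m n [seq a * x | x <- s].
Proof.
apply/matrixP => i j; rewrite !mxE mulrnAr.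
have [lt_i|le_i] := ltnP i (size s); first by rewrite (nth_map 0).
by rewrite !nth_default ?size_map // mulr0.
Qed.

(** Read from right to left, this is one elimination step with pivot [a], where [P *m E *m Q] is the
    Schur complement. *)
Lemma mulmx_block_pivot m n p q (a : D) (c : 'cV[D]_m) P
    (E : 'M[D]_(p, q)) (r : 'rV[D]_n) Q :
  block_mx a%:M 0 c P *m block_mx 1%:M 0 0 E *m block_mx 1%:M r 0 Q =
    block_mx a%:M (a *: r) c (c *m r + P *m E *m Q).
Proof.
rewrite !mulmx_block !(mulmx0, mul0mx, mulmx1, mul1mx, addr0, add0r).
by rewrite mul_scalar_mx.
Qed.

Lemma unitmx_lblock m (a : D) (c : 'cV[D]_m) P :
    a \is a GRing.unit -> P \in unitmx ->
  (block_mx a%:M 0 c P : 'M_(1 + m)) \in unitmx.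
Proof.
by move=> a_unit; rewrite !unitmxE det_lblock det_scalar1 unitrM a_unit.
Qed.

Lemma unitmx_ublock m (r : 'rV[D]_m) P :
  P \in unitmx -> (block_mx 1%:M r 0 P : 'M_(1 + m)) \in unitmx.
Proof. by rewrite !unitmxE det_ublock det1 mul1r. Qed.

Lemma smith_normal_form_exists m n (M : 'M[D]_(m, n)) :
  exists s, smith_normal_form z M s.
Proof.
elim: m n M => [|m IHm] n M.
  exists [::]; split=> //; exists 1%:M, 1%:M; rewrite !unitmx1; split=> //.
  by rewrite rect_diag_nil mul1mx mul0mx [M]flatmx0.
have [->|M_neq0] := eqVneq M 0.
  exists [::]; split=> //; exists 1%:M, 1%:M; rewrite !unitmx1; split=> //.
  by rewrite rect_diag_nil mul1mx mul0mx.
case: n M M_neq0 => [|n] M M_neq0; first by rewrite [M]thinmx0 eqxx in M_neq0.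
have [e [M' [i [j [ME unitM']]]]] := divide_out_pivot M_neq0.
(* Row and column swaps bring the unit pivot to the top left corner. *)
pose N : 'M[D]_(1 + m, 1 + n) := xrow i ord0 (xcol j ord0 M').
have M'E : M' = tperm_mx i ord0 *m N *m tperm_mx j ord0.
  by rewrite -xrowE -xcolE; apply/matrixP => i' j'; rewrite !mxE !tpermK.
have [a a_unit NE] : exists2 a, a \is a GRing.unit &
    N = block_mx a%:M (ursubmx N) (dlsubmx N) (drsubmx N).
  exists (M' i j) => //; rewrite -[LHS]submxK; congr block_mx.
  apply/matrixP => i' j'; rewrite !ord1 !mxE eqxx mulr1n.
  have -> : lshift m (0 : 'I_1) = ord0 :> 'I_m.+1 by apply/val_inj.
  have -> : lshift n (0 : 'I_1) = ord0 :> 'I_n.+1 by apply/val_inj.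
  by rewrite !tpermR.
have [s [size_s sorted_s [P [Q [P_unit Q_unit BE]]]]] :=
  IHm n (drsubmx N - a^-1 *: (dlsubmx N *m ursubmx N)).
(* The Schur complement was formed after dividing by [z ^+ e], so its exponents are shifted by [e];
   this also makes [e] the least one. *)
exists (e :: [seq (e + i)%N | i <- s]); split.
- by rewrite /= size_map minnSS.
- rewrite /= path_sortedE; last exact: leq_trans.
  rewrite all_map; apply/andP; split; first by apply/allP => x _; apply: leq_addr.
  by rewrite sorted_map; apply: sub_sorted sorted_s => x y; rewrite /= leq_add2l.
exists (tperm_mx i ord0 *m (block_mx a%:M 0 (dlsubmx N) P)).
exists ((block_mx 1%:M (a^-1 *: ursubmx N) 0 Q) *m tperm_mx j ord0).
rewrite !unitmx_mul !unitmx_perm unitmx_lblock // unitmx_ublock //; split=> //.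
set d := rect_diag _ _ _.
have -> : d = z ^+ e *:
    (block_mx 1%:M 0 0 (rect_diag m n [seq z ^+ i | i <- s]) :
       'M_(1 + m, 1 + n)).
  rewrite -(rect_diag_cons m n 1) scale_rect_diag /d /= mulr1 -!map_comp.
  by congr (rect_diag _ _ (_ :: _)); apply: eq_map => x /=; rewrite exprD.
rewrite -!(scalemxAr, scalemxAl) ME; congr (_ *: _).
rewrite M'E !mulmxA; congr (_ *m _); rewrite -!mulmxA; congr (_ *m _).
rewrite mulmxA; apply: etrans (esym (mulmx_block_pivot _ _ _ _ _ _)).
by rewrite {1}NE -BE scalerA divrr // scale1r -scalemxAr addrC subrK.
Qed.

End SmithNormalForm.

(** * Bounds on the exponents and recovery of a single symbol *)

Section Decoding.
Variables (D : idomainType) (z : D).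

Lemma rect_diag_mul_diag m n (d : seq D) (X : 'M[D]_(n, m)) (j : 'I_m) :
  exists c, (rect_diag m n d *m X) j j = d`_j * c.
Proof.
rewrite mxE; exists (\sum_k X k j *+ (j == k :> nat)); rewrite mulr_sumr.
by apply: eq_bigr => k _; rewrite mxE mulrnAl mulrnAr.
Qed.

(** Conjugating [M *m B] by [P] puts the diagonal factor first and preserves the shape
    [a *: (1%:M + z *: K)]. *)
Lemma diag_divides m n (M : 'M[D]_(m, n)) B K (a : D) P d Q :
    M *m B = a *: (1%:M + z *: K) -> P \in unitmx ->
    M = P *m rect_diag m n d *m Q ->
  forall j : 'I_m, exists c x, d`_j * c = a * (1 + z * x).
Proof.
move=> MB P_unit ME j.
have := rect_diag_mul_diag d (Q *m B *m P) j.
have -> : rect_diag m n d *m (Q *m B *m P) = invmx P *m (M *m B) *m P.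
  by rewrite ME !mulmxA mulVmx // mul1mx.
rewrite MB -scalemxAr -scalemxAl mulmxDr mulmxDl mulmx1 mulVmx //.
rewrite -scalemxAr -scalemxAl => -[c].
move: (invmx P *m K *m P) => X; rewrite !mxE eqxx => cE.
by exists c, (X j j).
Qed.

Hypotheses (z_neq0 : z != 0) (z_nu : z \isn't a GRing.unit).

Lemma one_add_multiple_not_divides (x y : D) : 1 + z * x = z * y -> False.
Proof.
move=> zxy; case/negP: z_nu; apply/unitrPr; exists (y - x).
by rewrite mulrBr -zxy addrK.
Qed.

Lemma exponents_le m n (M : 'M[D]_(m, n)) B K delta P s Q :
    M *m B = z ^+ delta *: (1%:M + z *: K) -> P \in unitmx ->
    M = P *m rect_diag m n [seq z ^+ i | i <- s] *m Q ->
  forall j : 'I_m, (j < size s)%N /\ (nth 0%N s j <= delta)%N.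
Proof.
move=> MB P_unit ME j; have [c [x]] := diag_divides MB P_unit ME j.
have [lt_j|le_j] := ltnP j (size s); last first.
  (* Past the end of [s] the diagonal entry is the default 0, which would force [1 + z * x = 0]. *)
  rewrite nth_default ?size_map // mul0r => /esym/eqP.
  rewrite mulf_eq0 expf_eq0 (negPf z_neq0) andbF /= => /eqP x0; exfalso.
  by apply: (@one_add_multiple_not_divides x 0); rewrite x0 mulr0.
rewrite (nth_map 0%N) // => cE; split=> //; rewrite leqNgt; apply/negP => lt_d.
(* An exponent above [delta] leaves a factor [z] once [z ^+ delta] is cancelled. *)
apply: (@one_add_multiple_not_divides x (z ^+ (nth 0%N s j - delta.+1) * c)).
apply: (mulfI (expf_neq0 delta z_neq0)).
by rewrite -cE !mulrA -exprSr -exprD subnKC.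
Qed.

Variable R : {pred D}.

Lemma power_series_mx_remainder m n (M : 'M[D]_(m, n)) Mj k :
    power_series_mx z R M Mj ->
  exists H, M = \sum_(j < k) z ^+ j *: Mj j + z ^+ k *: H.
Proof.
move=> expM; have [|H HE] := @divides_mx D (z ^+ k) m n
    (M - \sum_(j < k) z ^+ j *: Mj j).
  move=> i j; have [_ /(_ k) zMij] := expM i j; rewrite !mxE summxE.
  by under [X in _ - X]eq_bigr do rewrite mxE.
by exists H; rewrite -HE addrC subrK.
Qed.

(** [truncation] has [d.+1] terms; the extra power of [z] in the error is what later turns it into a
    multiple of [z] beside the identity. *)
Lemma truncation_remainder m n (M : 'M[D]_(m, n)) Mj d :
    power_series_mx z R M Mj ->
  exists H, M = truncation z Mj d + z ^+ d.+1 *: H.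
Proof. exact: power_series_mx_remainder. Qed.

Lemma rect_diag_mul_complement m n (s : seq nat) delta :
    (m <= n)%N -> size s = m -> {in s, forall e, (e <= delta)%N} ->
  rect_diag m n [seq z ^+ e | e <- s] *m
    rect_diag n m [seq z ^+ (delta - e) | e <- s] = (z ^+ delta)%:M.
Proof.
move=> le_mn size_s s_le; apply/matrixP => i j; rewrite !mxE.
have lt_i : (i < size s)%N by rewrite size_s.
(* Row [i] of the left factor is supported on column [i]; its exponent and the complementary one add
   up to [delta]. *)
rewrite (bigD1 (widen_ord le_mn i)) //= big1 => [|k neq_k].
  rewrite !mxE /= eqxx !(nth_map 0%N) // addr0 mulrnAr -exprD subnKC //.
  exact/s_le/mem_nth.
rewrite !mxE; have [ik|] := eqVneq (i : nat) k; last by rewrite mulr0n mul0r.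
by case/eqP: neq_k; apply/val_inj.
Qed.

Lemma is_quotient_scale n (c : D) (q : 'rV[D]_n) :
  c != 0 -> is_quotient (c *: q) c q.
Proof.
move=> c_neq0; rewrite /is_quotient map_mxZ scalerA mulVf ?scale1r //.
by rewrite tofrac_eq0.
Qed.

Variable sigma : D -> D.
Hypothesis repR : coset_representatives z R.
Hypothesis sigmaP : representative_map z R sigma.

Lemma representative_mapE (a r b : D) : r \in R -> a = r + z * b -> sigma a = r.
Proof.
move=> rR aE; have [r' [_ r'_uniq]] := repR a.
have [sR [c cE]] := sigmaP a.
have <- : r' = sigma a.
  by apply: r'_uniq; split=> //; exists (- c); rewrite mulNr -cE opprB.
by apply: r'_uniq; split=> //; exists b; rewrite aE addrC addKr mulrC.
Qed.

(** Here [u'] is the part of the source vector [u] already decoded, [ut] the next symbol, and [r'],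
    [F'] are the truncated received vector and matrix. *)
Lemma decode_symbol m n (G F' : 'M[D]_(m, n)) A0 K Phi delta t
    (u u' ut mu : 'rV[D]_m) (r' rho : 'rV[D]_n) :
    G *m A0 = z ^+ delta *: (1%:M + z *: K) ->
    G = F' + z ^+ (t + delta).+1 *: Phi ->
    u = u' + z ^+ t *: (ut + z *: mu) ->
    u *m G = r' + z ^+ (t + delta).+1 *: rho ->
    (forall j, ut 0 j \in R) ->
  exists2 q, is_quotient ((r' - u' *m F') *m A0) (z ^+ (delta + t)) q &
    ut = map_mx sigma q.
Proof.
move=> GA0 GE uE uG utR.
(* [w] collects the later symbols ([mu]), the defect of [A0] as a decoder ([K]) and the truncation
   errors of [r'] and [F']. *)
pose w := mu + (ut + z *: mu) *m K - (rho - u' *m Phi) *m A0.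
exists (ut + z *: w); last first.
  apply/rowP => j; rewrite !mxE.
  by apply/esym/(@representative_mapE _ _ (w 0 j)); rewrite ?mxE.
suff -> : (r' - u' *m F') *m A0 = z ^+ (delta + t) *: (ut + z *: w).
  exact/is_quotient_scale/expf_neq0.
have -> : r' - u' *m F' =
    z ^+ t *: ((ut + z *: mu) *m G - z ^+ delta.+1 *: (rho - u' *m Phi)).
  have -> : r' = u *m G - z ^+ (t + delta).+1 *: rho by rewrite uG addrK.
  have -> : F' = G - z ^+ (t + delta).+1 *: Phi by rewrite GE addrK.
  rewrite mulmxBr -scalemxAr opprB addrACA addrC {1}uE mulmxDl.
  rewrite -scalemxAl scalerBr scalerA -exprD addnS scalerBr opprB.
  by rewrite -!addrA addKr addrCA [- _ + _]addrC.
rewrite -scalemxAl mulmxBl -mulmxA GA0 -!scalemxAr -scalemxAl exprSr -!scalerA.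
rewrite -scalerBr scalerA -exprD addnC; congr (_ *: _).
by rewrite mulmxDr mulmx1 -scalemxAr /w scalerBr scalerDr !addrA.
Qed.

End Decoding.

(** * Invariant factors of the truncated matrix and sequential decoding *)

Theorem mainTheorem3
    (D : idomainType) (z : D) (R : {pred D}) (sigma : D -> D)
    (N : network) (omega : nat) (k : channel N -> channel N -> D)
    (f : channel N -> 'cV[D]_omega) (v : node N) (delta : nat)
    (F : nat -> 'M[D]_(omega, #|In v|))
    (dvrD : is_dvr D) (unif_z : uniformizer z)
    (repR : coset_representatives z R) (R0 : 0 \in R)
    (sigmaP : representative_map z R sigma)
    (omega_gt0 : (0 < omega)%N) (card_src : #|Out (source N)| = omega)
    (causal_k : causal z k) (codef : coding_vectors k f)
    (decv : decodable z f v delta)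
    (expF : power_series_mx z R (received_mx f v) F) :
  (exists i : omega.-tuple nat,
     invariant_factors z (truncation z F delta) i) /\
  (forall i : omega.-tuple nat,
     invariant_factors z (truncation z F delta) i ->
     (forall j : 'I_omega, (tnth i j <= delta)%N) /\
     (forall (U : 'M[D]_omega) (V : 'M[D]_#|In v|),
        U \in unitmx -> V \in unitmx ->
        truncation z F delta
          = U *m rect_diag omega #|In v| [seq z ^+ e | e <- i] *m V ->
        forall (A : 'M[D]_(#|In v|, omega))
               (Aj : nat -> 'M[D]_(#|In v|, omega)),
        A = invmx V *m
              rect_diag #|In v| omega [seq z ^+ (delta - e) | e <- i] *m
              invmx U ->
        power_series_mx z R A Aj ->
        let A0 := truncation z Aj delta in
        forall (m : 'rV[D]_omega) (mj : nat -> 'rV[D]_omega)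
               (r : 'rV[D]_#|In v|) (rj : nat -> 'rV[D]_#|In v|),
        power_series_mx z R m mj ->
        r = m *m received_mx f v ->
        power_series_mx z R r rj ->
        (exists2 q : 'rV[D]_omega,
           is_quotient (truncation z rj delta *m A0) (z ^+ delta) q &
           mj 0%N = map_mx sigma q) /\
        (forall t : nat, (1 <= t)%N ->
           exists2 q : 'rV[D]_omega,
             is_quotient
               ((truncation z rj (t + delta)
                 - truncation z mj (t - 1) *m truncation z F (t + delta))
                *m A0)
               (z ^+ (delta + t)) q &
             mj t = map_mx sigma q))).
Proof.
have [PID loc Nfield] := dvrD.
have z_neq0 := uniformizer_neq0 Nfield unif_z.
have z_nu := uniformizer_nonunit unif_z.
set G := received_mx f v in expF *.
have [A' GA'] := decv; rewrite -/G in GA'.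
have [H GE] := truncation_remainder delta expF.
have TA' : truncation z F delta *m A' = z ^+ delta *: (1%:M + z *: - (H *m A')).
  rewrite scalerDr scale_scalar_mx mulr1 -GA' {1}GE mulmxDl.
  by rewrite scalerN scalerN scalerA -exprSr -scalemxAl addrK.
have exp_le := exponents_le z_neq0 z_nu TA'.
split.
  have [s snf] := smith_normal_form_exists dvrD unif_z (truncation z F delta).
  have [size_s _ [P [Q [P_unit _ TE]]]] := snf.
  (* A shorter list would have a row with index [size s], contradicting the strict bound in
     [exp_le]. *)
  have size_s_omega : size s == omega.
    rewrite eqn_leq (leq_trans size_s (geq_minl _ _)) /=.
    rewrite leqNgt; apply/negP => lt_s.
    by have [] := exp_le _ _ _ P_unit TE (Ordinal lt_s); rewrite ltnn.
  by exists (Tuple size_s_omega), s.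
move=> i [s [size_s _ [P [Q [P_unit _ TE]]]] perm_i].
have size_s_omega : size s = omega by rewrite -(perm_size perm_i) size_tuple.
(* The bound is a property of the multiset of exponents, so it passes from the sorted list to any
   reordering. *)
have i_le : {in i, forall e, (e <= delta)%N}.
  move=> e; rewrite (perm_mem perm_i) => /(nthP 0%N)[j lt_j <-].
  rewrite size_s_omega in lt_j.
  by have [] := exp_le _ _ _ P_unit TE (Ordinal lt_j).
have le_omega : (omega <= #|In v|)%N.
  by move: size_s; rewrite size_s_omega leq_min => /andP[].
split=> [j|U V U_unit V_unit TUV A Aj AE expA A0 m mj r rj expm rE expr].
  exact/i_le/mem_tnth.
have TA : truncation z F delta *m A = (z ^+ delta)%:M.
  rewrite TUV AE !mulmxA mulmxK // -[U *m _ *m _]mulmxA.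
  rewrite rect_diag_mul_complement ?size_tuple //.
  by rewrite mul_mx_scalar -scalemxAl mulmxV // scale_scalar_mx mulr1.
have [B A0E] := truncation_remainder delta expA.
have GA0 : G *m A0 = z ^+ delta *: (1%:M + z *: (H *m A - G *m B)).
  have -> : A0 = A - z ^+ delta.+1 *: B by rewrite A0E addrK.
  rewrite mulmxBr {1}GE mulmxDl TA -scalemxAl -scalemxAr.
  by rewrite scalerDr scale_scalar_mx mulr1 scalerA -exprSr scalerBr addrA.
(* Writing the decoded part as a sum over [j < t] covers [t = 0], where it is empty and nothing is
   subtracted. *)
have step t (u' : 'rV_omega) F' Phi : u' = \sum_(j < t) z ^+ j *: mj j ->
    G = F' + z ^+ (t + delta).+1 *: Phi ->
  exists2 q, is_quotient ((truncation z rj (t + delta) - u' *m F') *m A0)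
      (z ^+ (delta + t)) q & mj t = map_mx sigma q.
  move=> u'E GE'.
  have [mu mE] := power_series_mx_remainder t.+1 expm.
  have [rho rE'] := truncation_remainder (t + delta) expr.
  apply: (decode_symbol z_neq0 repR sigmaP GA0 GE' (u := m) (mu := mu) _ (rho := rho)).
  - by rewrite mE big_ord_recr /= -u'E scalerDr scalerA -exprSr addrA.
  - by rewrite -rE.
  - by move=> j; have [] := expm 0 j.
split=> [|t t_gt0].
  have := step 0%N 0 _ _ _ GE.
  by rewrite big_ord0 mul0mx subr0 addn0; apply.
have [Phi GE'] := truncation_remainder (t + delta) expF.
apply: (step t _ _ _ _ GE').
(* For [t >= 1], truncating at [t - 1] keeps exactly [t] terms. *)
by rewrite /truncation subn1 prednK.
Qed.
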